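(* For every $n\ge 1$ and every Boolean function $f:\{0,1\}^n \to \{0,1\}$, \[ \deg_{1/3}(f)^2 \geq \sqrt{\tfrac{6}{101}}\; bs(f). \]
   Context: A real polynomial $p$ on $\mathbb{R}^n$ is an $\varepsilon$-approximation of $f:\{0,1\}^n\to\{0,1\}$ if $|f(x)-p(x)|\le\varepsilon$ for all $x\in\{0,1\}^n$; $\deg_{1/3}(f)$ is the minimum degree of a $\tfrac13$-approximation of $f$. For $x\in\{0,1\}^n$ and $R\subseteq\{1,\dots,n\}$, $x^{(R)}$ is $x$ with the bits indexed by $R$ flipped. The local block sensitivity $bs(f,x)$ is the largest $t$ such that there exist pairwise disjoint $R_1,\dots,R_t\subseteq\{1,\dots,n\}$ with $f(x)\ne f(x^{(R_i)})$ for all $i$; $bs(f)=\max_x bs(f,x)$. *)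

(* Defs.v *)
From HB Require Import structures.
From mathcomp Require Import all_boot all_order all_algebra.
From mathcomp Require Import boolp reals.
From mathcomp Require Import mpoly.

Set Implicit Arguments.
Unset Strict Implicit.
Unset Printing Implicit Defensive.

Import Order.TTheory GRing.Theory Num.Theory.
Local Open Scope ring_scope.

Notation cube n := {ffun 'I_n -> bool}.

Definition embed (R : realType) (n : nat) (x : cube n) : 'I_n -> R :=
  fun i => (x i)%:R.

(* Total degree of a multivariate polynomial (msize p = 1 + degree). *)
Definition mdegree (R : realType) (n : nat) (p : {mpoly R[n]}) : nat :=
  (msize p).-1.

Definition eps_approx (R : realType) (n : nat) (eps : R) (p : {mpoly R[n]})
  (f : cube n -> bool) : Prop :=
  forall x : cube n, `|(f x)%:R - p.@[embed R x]| <= eps.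

Definition interp (R : realType) (n : nat) (f : cube n -> bool) : {mpoly R[n]} :=
  \sum_(y : cube n) (f y)%:R *: \prod_(i < n) (if y i then 'X_i else 1 - 'X_i).

Lemma interp_eval (R : realType) (n : nat) (f : cube n -> bool) (x : cube n) :
  (interp R f).@[embed R x] = (f x)%:R.
Proof.
rewrite /interp raddf_sum /= (bigD1 x) //=.
have -> : \sum_(y | y != x)
     ((f y)%:R *: \prod_(i < n) (if y i then 'X_i else 1 - 'X_i)).@[embed R x]
     = 0 :> R.
  apply: big1 => y yx; rewrite mevalZ rmorph_prod /=.
  have [i yi] : exists i, y i != x i.
    apply/existsP; apply: contraR yx => /existsPn H; apply/eqP/ffunP => i.
    by apply/eqP; move: (H i); rewrite negbK.
  rewrite (bigD1 i) //= mulrCA.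
  move: yi; rewrite /embed; case Eyi: (y i); case Exi: (x i) => //= _.
  - by rewrite mevalXU /= Exi mul0r.
  - by rewrite mevalB meval1 mevalXU /= Exi subrr mul0r.
rewrite addr0 mevalZ rmorph_prod /= big1 ?mulr1 // => i _.
rewrite /embed; case Exi: (x i); rewrite ?mevalB ?meval1 mevalXU /= Exi //.
by rewrite subr0.
Qed.

Lemma approx_exists (R : realType) (n : nat) (f : cube n -> bool) :
  exists d, `[< exists p : {mpoly R[n]},
                 eps_approx (3%:R^-1) p f /\ mdegree p = d >].
Proof.
exists (mdegree (interp R f)); apply/asboolP; exists (interp R f); split=> //.
by move=> x; rewrite interp_eval subrr normr0 invr_ge0 ler0n.
Qed.

Definition approx_deg (R : realType) (n : nat) (f : cube n -> bool) : nat :=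
  ex_minn (approx_exists R f).

Definition flip (n : nat) (x : cube n) (B : {set 'I_n}) : cube n :=
  [ffun i => x i (+) (i \in B)].

(* Local block sensitivity bs(f,x): the largest number of pairwise disjoint
   blocks B with f(x) != f(x^(B)).  Sensitive blocks are nonempty, so pairwise
   disjoint families of sensitive blocks are exactly the sets of blocks P
   with trivIset P (pairwise disjoint) all of whose members are sensitive. *)
Definition bs_at (n : nat) (f : cube n -> bool) (x : cube n) : nat :=
  \max_(P : {set {set 'I_n}} |
          trivIset P && [forall B in P, f (flip x B) != f x]) #|P|.

Definition bs (n : nat) (f : cube n -> bool) : nat :=
  \max_(x : cube n) bs_at f x.

(* Main.v *)
Require Import Defs.
From HB Require Import structures.
From mathcomp Require Import all_boot all_order all_algebra.
From mathcomp Require Import boolp reals.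
From mathcomp Require classical_sets functions topology normedtype derive.
From mathcomp Require Import trigo.
From mathcomp Require Import ring lra.
From mathcomp Require Import mpoly.
Set Implicit Arguments.
Unset Strict Implicit.
Unset Printing Implicit Defensive.
Import Order.TTheory GRing.Theory Num.Theory.
Local Open Scope ring_scope.

(** The bound proved is [deg^2 >= bs / 4], and [1/4 > sqrt (6/101)].

Let [p] approximate [f] with degree [d] and let [N] disjoint blocks be
sensitive at [x].  Flipping each block independently with probability [t]
makes the expectation of [p] a polynomial [q] in [t] of degree at most [d],
with values in [[-1/3, 4/3]] on all of [[0, 1]].  Up to replacing [q] by
[1 - q], [q 0 <= 1/3] and [q' 0 >= N (2/3 - q 0)].  An affine change of the
values makes [q 0 = 1/3] and [q' 0 >= N/3].

Put [r = q - 1/2], so [|r| <= 5/6] and [r 0 = -1/6].  Stretch the Chebyshev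
polynomial to [T = - T_d] on an interval [[a, 1]], [a < 0], so that
[T 0 = -1/5] before the first interior extremum, i.e. at angle [u / d] with
[cos u = 1/5].  Then [h = 5/6 T - r] vanishes at [0] and alternates weakly at
the [d] extrema of [T] in [(0, 1]].  If [h' 0 < 0], then [h / X], of degree
less than [d], alternates at [d + 1] points and is not zero there, which is
impossible.  Hence [r' 0 <= 5/6 T' 0 <= 5/3 d^2 / u <= 4/3 d^2], as
[u >= 5/4]. *)

(** * Elementary inequalities for sine and cosine *)

Module TrigInequalities.
Import classical_sets functions topology normedtype derive.
Local Open Scope classical_set_scope.
Import numFieldNormedType.Exports.

Section Bounds.
Context {R : realType}.
Implicit Types x : R.

Lemma sin_le x : 0 <= x -> sin x <= x.
Proof.
move=> x0.
have cont : {within `[0, x], continuous (@sin R)}.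
  by apply: continuous_subspaceT => z; exact: continuous_sin.
have [c _] := MVT_segment x0 (fun z _ => is_derive_sin z) cont.
rewrite sin0 !subr0 => ->.
by rewrite -[leRHS]mul1r ler_wpM2r// cos_le1.
Qed.

(** The function [sin z - z cos z] vanishes at 0 and has derivative [z sin z], nonnegative on
    [[0, pi]]. *)
Lemma mul_cos_le_sin x : 0 <= x <= pi -> x * cos x <= sin x.
Proof.
move=> /andP[x0 xpi].
pose f : R -> R := (@sin R) - ((@id R) * (@cos R)).
have df (z : R) : is_derive z 1 f (z * sin z).
  rewrite /f; apply: is_derive_eq; rewrite /GRing.scale /=; ring.
have cont : {within `[0, x], continuous f}.
  apply: derivable_within_continuous => z _.
  by case: (df z).
have [c] := MVT_segment x0 (fun z _ => df z) cont.
rewrite in_itv /= => /andP[c0 cx] E.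
have : 0 <= f x - f 0.
  rewrite E subr0 mulr_ge0// mulr_ge0// sin_ge0_pi// c0 /=; exact: le_trans xpi.
have fE z : f z = sin z - z * cos z by [].
by rewrite !fE sin0 mul0r !subr0 subr_ge0.
Qed.

(** Half-angle formula [cos x = 1 - 2 sin(x/2)^2] together with [sin(x/2) <= x/2]. *)
Lemma cos_ge x : 0 <= x <= pi -> 1 - x ^+ 2 / 2 <= cos x.
Proof.
move=> /andP[x0 xpi].
have -> : cos x = cos (x / 2) ^+ 2 *+ 2 - 1.
  by rewrite -cos_mulr2n; congr cos; lra.
rewrite cos2sin2.
have s0 : 0 <= sin (x / 2) by apply: sin_ge0_pi; apply/andP; split; lra.
have sx : sin (x / 2) <= x / 2 by apply: sin_le; lra.
have : sin (x / 2) ^+ 2 <= (x / 2) ^+ 2 by rewrite ler_sqr ?nnegrE//; lra.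
by rewrite exprMn; set y := sin _ ^+ 2; lra.
Qed.

End Bounds.
End TrigInequalities.

Import TrigInequalities.

(** * Divided differences and sign alternation *)

(** The sum is the coefficient of [X^m] in the Lagrange interpolant of [p] at the [m + 1] nodes, and
    this interpolant is [p] itself. *)
Lemma divided_difference_eq0 (F : fieldType) (m : nat) (t : 'I_m.+1 -> F)
    (p : {poly F}) :
  injective t -> (size p <= m)%N ->
  \sum_i p.[t i] / (\prod_(j | j != i) (t i - t j)) = 0.
Proof.
move=> t_inj sp.
pose w i := \prod_(j | j != i) (t i - t j).
pose N i : {poly F} := \prod_(j | j != i) ('X - (t j)%:P).
have w0 i : w i != 0.
  by apply/prodf_neq0 => j ji; rewrite subr_eq0 (inj_eq t_inj) eq_sym.
have sN i : size (N i) = m.+1.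
  by rewrite /N -big_filter size_prod_XsubC size_filter -sum1_count
    sum1_card cardC1 card_ord.
have Nt i k : (N i).[t k] = (i == k)%:R * w i.
  rewrite horner_prod; case: eqVneq => [->|ik].
    by rewrite mul1r; apply: eq_bigr => j _; rewrite hornerXsubC.
  by rewrite mul0r (bigD1 k) 1?eq_sym //= hornerXsubC subrr mul0r.
pose q : {poly F} := \sum_i (p.[t i] / w i) *: N i.
have sq : (size q <= m.+1)%N.
  apply: (leq_trans (size_sum _ _ _)); apply/bigmax_leqP => i _.
  by apply: (leq_trans (size_scale_leq _ _)); rewrite sN.
have pq : p = q.
  apply/eqP; rewrite -subr_eq0; apply: contraT => nz.
  have := max_poly_roots nz (_ : all _ (codom t)) (_ : uniq (codom t)).
  rewrite size_codom card_ord map_inj_uniq ?enum_uniq // => H.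
  have : (m.+1 < size (p - q)%R)%N.
    apply: H => //; apply/allP => _ /codomP[k ->].
    rewrite rootE hornerD hornerN horner_sum (bigD1 k) //= big1 ?addr0.
      by rewrite hornerZ Nt eqxx mul1r divfK ?subrr.
    by move=> i ik; rewrite hornerZ Nt (negPf ik) mul0r mulr0.
  by rewrite ltnNge (leq_trans (size_polyD _ _)) // geq_max size_polyN sq leqW.
transitivity q`_m; last by rewrite -pq nth_default.
rewrite coef_sum; apply: eq_bigr => i _; rewrite coefZ.
have := monic_prod_XsubC (index_enum 'I_m.+1) (fun j => j != i) t.
by rewrite monicE lead_coefE -/(N i) sN => /eqP ->; rewrite mulr1.
Qed.

(** Serves to count the negative factors [t i - t j] of a divided-difference weight with increasing
    nodes. *)
Lemma sum_ltn_ord (n i : nat) : (\sum_(j < n.+1) (i < j) = n - i)%N.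
Proof.
elim: n => [|n IH]; first by rewrite big_ord_recl big_ord0 ltn0.
rewrite big_ord_recr /= IH ltnS; case: (leqP i n) => h.
  by rewrite addn1 subSn.
by have := ltnW h; move: h; rewrite addn0 -!subn_eq0 => /eqP -> /eqP ->.
Qed.

(** The weight of node [i] has sign [(-1)^(m - i)]. Up to a global sign, the vanishing divided
    difference is thus a sum of nonnegative terms, so each term is zero. *)
Lemma alternating_eq0 (F : realFieldType) (m : nat) (t : 'I_m.+1 -> F)
    (p : {poly F}) :
  (forall i j : 'I_m.+1, (i < j)%N -> t i < t j) -> (size p <= m)%N ->
  (forall i : 'I_m.+1, 0 <= (-1) ^+ i * p.[t i]) -> forall i, p.[t i] = 0.
Proof.
move=> t_incr sp alt.
have t_inj : injective t.
  move=> i j; case: (ltngtP i j) => [/t_incr|/t_incr|/val_inj//] h e;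
    by rewrite e ltxx in h.
pose w i := \prod_(j | j != i) (t i - t j).
have wE i : w i = (-1) ^+ (m - i) * \prod_(j | j != i) `|t i - t j|.
  rewrite -(sum_ltn_ord m i) (bigD1 i) //= ltnn add0n -prodrXr -big_split /=.
  apply: eq_bigr => j ji; case: (ltnP i j) => h.
    by rewrite expr1 mulN1r ltr0_norm ?opprK // subr_lt0 t_incr.
  rewrite expr0 mul1r gtr0_norm // subr_gt0 t_incr // ltn_neqAle h andbT.
  by rewrite -val_eqE in ji.
have w_pos i : 0 < \prod_(j | j != i) `|t i - t j|.
  apply: prodr_gt0 => j ji; rewrite normr_gt0 subr_eq0 (inj_eq t_inj).
  by rewrite eq_sym.
have sgn2 n : (-1) ^+ n * (-1) ^+ n = 1 :> F by rewrite -exprMn mulrNN mulr1 expr1n.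
have term i : (-1) ^+ m * (p.[t i] / w i) =
    ((-1) ^+ i * p.[t i]) / \prod_(j | j != i) `|t i - t j|.
  have im : (i <= m)%N by rewrite -ltnS.
  have -> : (-1) ^+ m = (-1) ^+ (m - i) * (-1) ^+ i :> F by rewrite -exprD subnK.
  by rewrite wE invfM invr_sign [p.[_] * _]mulrCA mulrACA sgn2 mul1r mulrA.
have sum0 : \sum_(i : 'I_m.+1) ((-1) ^+ i * p.[t i]) / \prod_(j | j != i) `|t i - t j| = 0.
  rewrite -(eq_bigr _ (fun i _ => term i)) -mulr_sumr.
  by rewrite divided_difference_eq0 ?mulr0.
move=> i.
have /eqP := sum0; rewrite psumr_eq0; last first.
  by move=> j _; rewrite divr_ge0 // ltW.
move=> /allP /(_ i (mem_index_enum _)) /=.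
by rewrite mulf_eq0 invr_eq0 (gt_eqF (w_pos i)) orbF mulf_eq0 signr_eq0 /= => /eqP.
Qed.

(** * Chebyshev polynomials of the first kind *)

Section Chebyshev.
Context {R : realType}.

Fixpoint chebyshev (n : nat) : {poly R} :=
  match n with
  | 0 => 1
  | 1 => 'X
  | (m.+1 as k).+1 => 2%:P * 'X * chebyshev k - chebyshev m
  end.

Lemma chebyshevSS n :
  chebyshev n.+2 = 2%:P * 'X * chebyshev n.+1 - chebyshev n.
Proof. by []. Qed.

Lemma two_step_ind (P : nat -> Prop) :
  P 0%N -> P 1%N -> (forall n, P n -> P n.+1 -> P n.+2) -> forall n, P n.
Proof.
move=> P0 P1 PS n; suff: P n /\ P n.+1 by case.
by elim: n => [|n [IH1 IH2]]; split=> //; exact: PS.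
Qed.

Lemma size_chebyshev n : (size (chebyshev n) <= n.+1)%N.
Proof.
elim/two_step_ind: n => [||n IH1 IH2]; [by rewrite size_poly1|by rewrite size_polyX|].
rewrite chebyshevSS (leq_trans (size_polyD _ _)) // geq_max size_polyN.
rewrite (leq_trans IH1 (leqW (leqnSn _))) andbT -mulrA mul_polyC.
rewrite (leq_trans (size_scale_leq _ _)) // (leq_trans (size_polyMleq _ _)) //.
by rewrite size_polyX.
Qed.

Lemma horner_chebyshev n (x : R) : (chebyshev n).[cos x] = cos (n%:R * x).
Proof.
elim/two_step_ind: n => [||n IH1 IH2].
- by rewrite hornerC mul0r cos0.
- by rewrite hornerX mul1r.
rewrite chebyshevSS !hornerE IH1 IH2.
have -> : n.+2%:R * x = n.+1%:R * x + x by ring.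
have -> : n%:R * x = n.+1%:R * x - x by ring.
rewrite cosB cosD; ring.
Qed.

(** This is [T_n(cos x) = cos(n x)] differentiated in [x], obtained algebraically from the
    recurrence. *)
Lemma horner_deriv_chebyshev n (x : R) :
  ((chebyshev n)^`()).[cos x] * sin x = n%:R * sin (n%:R * x).
Proof.
elim/two_step_ind: n => [||n IH1 IH2].
- by rewrite derivC hornerC !mul0r.
- by rewrite derivX hornerC !mul1r.
rewrite chebyshevSS !derivE !hornerE mulrBl IH1 mulrDl -!mulrA IH2.
rewrite horner_chebyshev.
have -> : n.+2%:R * x = n.+1%:R * x + x by ring.
have -> : n%:R * x = n.+1%:R * x - x by ring.
rewrite sinB sinD; ring.
Qed.

End Chebyshev.

(** * Derivative at the endpoint 0 of a polynomial bounded on [[0, 1]] *)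

Section EndpointDerivative.
Context {R : realType}.

(** Indeed [cos(5/4) >= 1 - 25/32 = 7/32 > 1/5], and cosine decreases on [[0, pi]]. *)
Lemma acos_fifth_ge : 5 / 4 <= acos (5^-1 : R).
Proof.
have i5 : -1 <= (5^-1 : R) <= 1 by apply/andP; split; lra.
have pi2 := @pi_ge2 R.
rewrite leNgt; apply/negP => lt.
have : cos (5 / 4 : R) < cos (acos 5^-1).
  by rewrite ltr_cos ?in_itv //= ?acos_ge0 ?acos_lepi //; apply/andP; split; lra.
rewrite acosK ?in_itv //=.
have : 1 - (5 / 4) ^+ 2 / 2 <= cos (5 / 4 : R).
  by apply: cos_ge; apply/andP; split; lra.
lra.
Qed.

(** With [z = x/2] this reads [4 z cos(z)^2 <= 4 sin z cos z], which is [mul_cos_le_sin] times a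
    nonnegative cosine. *)
Lemma mul_cosD1_le (x : R) : 0 <= x <= pi -> x * (1 + cos x) <= 2 * sin x.
Proof.
move=> /andP[x0 xpi].
have -> : cos x = cos (x / 2) ^+ 2 *+ 2 - 1 by rewrite -cos_mulr2n; congr cos; lra.
have -> : sin x = (cos (x / 2) * sin (x / 2)) *+ 2.
  by rewrite -sin_mulr2n; congr sin; lra.
have c0 : 0 <= cos (x / 2) by apply: cos_ge0_pihalf; apply/andP; split; lra.
have : x / 2 * cos (x / 2) <= sin (x / 2).
  by apply: mul_cos_le_sin; apply/andP; split; lra.
by move=> /(ler_wpM2l c0); nra.
Qed.

Lemma coef1_le (d : nat) (r : {poly R}) :
  (size r <= d.+1)%N -> (forall t, 0 <= t <= 1 -> `|r.[t]| <= 5 / 6) ->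
  r.[0] = - 6^-1 -> r`_1 <= 4 / 3 * d%:R ^+ 2.
Proof.
case: d => [|d'] sr r_le r0; first by rewrite nth_default // expr0n mulr0.
set d := d'.+1 in sr *.
have d0 : 0 < d%:R :> R by rewrite ltr0n.
pose u : R := acos 5^-1; pose th := u / d%:R; pose c := cos th.
have i5 : -1 <= (5^-1 : R) <= 1 by apply/andP; split; lra.
have uge : 5 / 4 <= u := acos_fifth_ge.
have ult : u < pi by apply: acos_ltpi; apply/andP; split; lra.
have cosu : cos u = 5^-1 by rewrite acosK // in_itv.
have dth : d%:R * th = u by rewrite mulrC divfK ?gt_eqF.
have d1 : 1 <= d%:R :> R by rewrite ler1n.
have th0 : 0 < th by apply: divr_gt0 => //; lra.
have thu : th <= u by rewrite ler_pdivrMr // ler_peMr //; lra.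
have thpi : 0 < th < pi by rewrite th0 (le_lt_trans thu).
have sth : 0 < sin th by exact: sin_gt0_pi.
have c1 : 0 < 1 + c.
  rewrite -ltrBlDl sub0r -cospi ltr_cos ?in_itv /= ?lexx ?pi_ge0 //; lra.
(* [y] decreases from [cos th] at 0 to [-1] at 1. Hence [T] is [- cos u = -1/5] at 0, and [5/6 T]
   agrees there with [r]. *)
pose y : {poly R} := c%:P - (1 + c) *: 'X.
have yE x : y.[x] = c - (1 + c) * x by rewrite /y !hornerE.
pose T : {poly R} := - (chebyshev d \Po y).
pose h : {poly R} := (5 / 6) *: T - r.
have h0 : h.[0] = 0.
  rewrite /h /T hornerD hornerZ !hornerN horner_comp yE mulr0 subr0.
  by rewrite horner_chebyshev dth cosu r0; lra.
have [g hE] : exists g, h = g * 'X.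
  have /factor_theorem[g] : root h 0 by apply/rootP.
  by rewrite subr0; exists g.
(* As [h = g X], the value of [g] at 0 is [h'(0)]. *)
have g0E : g.[0] = 5 / 6 * ((1 + c) * ((chebyshev d)^`()).[c]) - r`_1.
  transitivity (h^`()).[0].
    by rewrite hE derivM derivX mulr1 hornerD hornerM hornerX mulr0 add0r.
  rewrite /h /T derivB derivZ derivN deriv_comp !hornerE /= horner_comp yE mulr0 subr0.
  rewrite (_ : (y^`()).[0] = - (1 + c)); last by rewrite /y !derivE !hornerE.
  rewrite (_ : (r^`()).[0] = r`_1); last by rewrite horner_coef0 coef_deriv.
  ring.
(* The left side is [(1 + cos th) d sin u / sin th <= 2 d / th = 2 d^2 / u], and [u >= 5/4]. *)
have cheb_le : (1 + c) * ((chebyshev d)^`()).[c] <= 8 / 5 * d%:R ^+ 2.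
  set D := ((chebyshev d)^`()).[c].
  have DE : D * sin th = d%:R * sin u by rewrite /D /c horner_deriv_chebyshev dth.
  have su := sin_le1 u.
  have A1 : th * (1 + c) <= 2 * sin th.
    by apply: mul_cosD1_le; case/andP: thpi => ? ?; apply/andP; split; exact: ltW.
  have D0 : 0 <= D.
    rewrite -(pmulr_lge0 _ sth) DE mulr_ge0 ?ltW // sin_gt0_pi // ult andbT; lra.
  have A2 : (1 + c) * D * u <= 2 * d%:R ^+ 2.
    rewrite -(ler_pM2r sth) -dth.
    have -> : (1 + c) * D * (d%:R * th) * sin th =
      (th * (1 + c)) * (d%:R * (D * sin th)) by ring.
    rewrite DE.
    have -> : 2 * d%:R ^+ 2 * sin th = (2 * sin th) * (d%:R * (d%:R * 1)) by ring.
    apply: ler_pM => //; first by rewrite mulr_ge0 // ltW.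
      by rewrite -DE !mulr_ge0 // ltW.
    by rewrite !ler_pM2l.
  have X0 : 0 <= (1 + c) * D by rewrite mulr_ge0 // ltW.
  have : (1 + c) * D * (5 / 4) <= (1 + c) * D * u by rewrite ler_wpM2l.
  by move: A2; set X := (1 + c) * D; set Y := _ * u; set Z := _ ^+ 2; lra.
rewrite leNgt; apply/negP => lt.
have g0 : g.[0] < 0.
  by rewrite g0E; move: cheb_le lt; set X := (1 + c) * _; set Z := _ ^+ 2; lra.
(* For [i >= 1] the node is the preimage under [y] of the extremal point [cos(i pi / d)]. The
   preimage for [i = 0] would be negative and is replaced by 0. *)
pose t (i : 'I_d.+1) : R :=
  if i == 0%N :> nat then 0 else (c - cos (i%:R * (pi / d%:R))) / (1 + c).
have pd0 : 0 < pi / d%:R :> R by rewrite divr_gt0 ?pi_gt0.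
have ang_le (i : nat) : (i <= d)%N -> i%:R * (pi / d%:R) \in `[(0 : R), pi].
  move=> id; rewrite in_itv /= mulr_ge0 ?(ltW pd0) //= mulrCA ler_piMr ?pi_ge0 //.
  by rewrite ler_pdivrMr // mul1r ler_nat.
have t_incr (i j : 'I_d.+1) : (i < j)%N -> t i < t j.
  have jd : (j <= d)%N by rewrite -ltnS.
  have id : (i <= d)%N by rewrite -ltnS.
  move=> ij; rewrite /t [j == 0%N :> nat]gtn_eqF ?(leq_ltn_trans _ ij) //.
  case: eqP => i0.
    rewrite divr_gt0 // subr_gt0 ltr_cos ?ang_le //; last first.
      by rewrite in_itv /= !ltW //; case/andP: thpi.
    rewrite /th mulrA ltr_pM2r ?invr_gt0 //.
    by rewrite (lt_le_trans ult) // ler_peMl ?pi_ge0 // ler1n -i0.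
  rewrite ltr_pM2r ?invr_gt0 // ltrD2l ltrN2 ltr_cos ?ang_le //.
  by rewrite ltr_pM2r // ltr_nat.
have t_le1 i : t i <= 1.
  rewrite /t; case: eqP => _ //; rewrite ler_pdivrMr // mul1r.
  by have := @cos_geN1 R (i%:R * (pi / d%:R)); set X := cos (_ * _); lra.
have t_gt0 (i : 'I_d.+1) : (0 < i)%N -> 0 < t i.
  by move=> i0; have := t_incr ord0 i i0; rewrite {1}/t eqxx.
have sg : (size (- g) <= d)%N.
  have [->|gn] := eqVneq g 0; first by rewrite oppr0 size_poly0.
  rewrite size_polyN -ltnS -size_mulX // -hE.
  rewrite (leq_trans (size_polyD _ _)) // geq_max size_polyN sr andbT.
  rewrite (leq_trans (size_scale_leq _ _)) // size_polyN.
  have sy : (size y <= 2)%N.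
    rewrite (leq_trans (size_polyD _ _)) // geq_max size_polyN.
    by rewrite (leq_trans (size_polyC_leq1 _)) //= (leq_trans (size_scale_leq _ _)) ?size_polyX.
  have := size_comp_poly_leq (chebyshev d) y.
  move=> /leq_trans; apply; rewrite ltnS.
  have := @size_chebyshev R d.
  move: sy; case: (size y) => [|[|[|//]]] //=; rewrite ?muln0 ?muln1 //.
  by case: (size _).
(* Alternation would force [g] to vanish at every node, in particular at 0, where it is negative. *)
have := alternating_eq0 t_incr sg.
suff: forall i : 'I_d.+1, 0 <= (-1) ^+ i * (- g).[t i].
  by move=> H /(_ H ord0); rewrite /t eqxx hornerN; lra.
move=> i; have [i0|i0] := posnP i.
  by rewrite /t i0 eqxx mul1r hornerN; lra.
(* Multiplying by [t i > 0] turns [g] into [h]; as [T] is [-(-1)^i] at this node, the quantity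
   becomes [5/6 + (-1)^i r(t i)]. *)
rewrite -(pmulr_lge0 _ (t_gt0 _ i0)).
have -> : (-1) ^+ i * (- g).[t i] * t i = (-1) ^+ i * - h.[t i].
  by rewrite hE hornerM hornerX hornerN; ring.
have yt : y.[t i] = cos (i%:R * (pi / d%:R)).
  by rewrite yE /t gtn_eqF // mulrC divfK ?gt_eqF //; ring.
have cosi : cos (d%:R * (i%:R * (pi / d%:R))) = (-1) ^+ i :> R.
  rewrite (_ : d%:R * _ = 0 + pi *+ i).
    by rewrite (alternatingn (@cosDpi R)) cos0 mulr1.
  by rewrite add0r -mulr_natr; field; rewrite gt_eqF.
rewrite /h /T hornerD hornerZ !hornerN horner_comp yt horner_chebyshev cosi.
have := r_le (t i); rewrite t_le1 ltW ?t_gt0 // => /(_ isT).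
rewrite -signr_odd; case: (odd i); rewrite ?expr0 ?expr1 ler_norml => /andP[]; lra.
Qed.

(** Contracting the values of [r] towards [5/6] reduces the claim to [coef1_le]. *)
Lemma bounded_jump_le (d : nat) (N : R) (r : {poly R}) :
  (size r <= d.+1)%N -> (forall t, 0 <= t <= 1 -> `|r.[t]| <= 5 / 6) ->
  r.[0] <= - 6^-1 -> 0 <= N -> N * (6^-1 - r.[0]) <= r`_1 ->
  N <= 4 * d%:R ^+ 2.
Proof.
move=> sr r_le r0 N0 rN.
have r0_ge : - (5 / 6) <= r.[0].
  by have := r_le 0; rewrite lexx ler01 => /(_ isT); rewrite ler_norml => /andP[].
pose a := (5 / 6 - r.[0])^-1.
have a0 : 0 < a by rewrite invr_gt0; lra.
have aE : a * (5 / 6 - r.[0]) = 1 by rewrite mulVf // gt_eqF //; lra.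
have a1 : a <= 1 by rewrite invf_le1; lra.
(* [a] and the constant are chosen so that [s.[0] = -1/6] and the upper bound
   [5/6] is preserved. *)
pose s : {poly R} := a *: r + ((1 - a) * (5 / 6))%:P.
have := @coef1_le d s.
have -> : (size s <= d.+1)%N.
  rewrite (leq_trans (size_polyD _ _)) // geq_max (leq_trans (size_scale_leq _ _)) //=.
  by rewrite (leq_trans (size_polyC_leq1 _)).
move=> /(_ isT); rewrite /s coefD coefZ coefC addr0.
have bnd t : 0 <= t <= 1 -> `|s.[t]| <= 5 / 6.
  move=> /r_le; rewrite /s hornerD hornerZ hornerC !ler_norml => /andP[h1 h2].
  by apply/andP; split; nra.
move=> /(_ bnd); rewrite hornerD hornerZ hornerC.
have -> : a * r.[0] + (1 - a) * (5 / 6) = - 6^-1 by lra.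
move=> /(_ erefl); set D := d%:R ^+ 2 => H.
suff : N / 3 <= a * r`_1 by lra.
apply: le_trans (_ : a * (N * (6^-1 - r.[0])) <= _); last by rewrite ler_pM2l.
(* The right side equals [1 - 2a/3], and [a <= 1]. *)
have : 1 / 3 <= a * (6^-1 - r.[0]) by nra.
by move=> /(ler_wpM2l N0); nra.
Qed.

End EndpointDerivative.

(** * Symmetrization by independent random block flips *)

Lemma deriv_prod (R : comNzRingType) (I : eqType) (s : seq I) (F : I -> {poly R}) :
  uniq s ->
  (\prod_(i <- s) F i)^`() =
    \sum_(i <- s) (F i)^`() * \prod_(j <- s | j != i) F j.
Proof.
elim: s => [|i s IH] /=; first by rewrite !big_nil derivC.
move=> /andP[is_ us]; rewrite !big_cons derivM IH // eqxx /=; congr (_ * _ + _).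
  rewrite big_seq_cond [RHS]big_seq_cond; apply: eq_bigl => j.
  by rewrite andbT; case: (boolP (j \in s)) => //= js; apply/esym; apply: contraNneq is_ => <-.
rewrite mulr_sumr; apply: eq_big_seq => j js.
by rewrite big_cons ifT 1?mulrCA //; apply: contraNneq is_ => ->.
Qed.

Section BernoulliSymmetrization.
Context {R : comNzRingType} {n : nat} {K : finType}.
Variables (p : {mpoly R[n]}) (blk : 'I_n -> K) (v : 'I_n -> bool -> R).

(** Variable [i] belongs to block [blk i] and takes the value [v i b] when the bit of its block is
    [b]. *)
Definition block_eval (y : {ffun K -> bool}) : R :=
  p.@[fun i => v i (y (blk i))].

Definition bernoulli_weight (t : R) (y : {ffun K -> bool}) : R :=
  \prod_k (if y k then t else 1 - t).

Definition block_monom (m : 'X_{1..n}) (k : K) (b : bool) : R :=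
  \prod_(i | blk i == k) v i b ^+ m i.

(** The expectation of [block_eval] when each block bit is 1 with probability [X]. By independence,
    the expectation of a monomial is a product over blocks; this form makes the degree visible. *)
Definition bernoulli_poly : {poly R} :=
  \sum_(m <- msupp p) p@_m *: \prod_k
    ((block_monom m k false)%:P
     + (block_monom m k true - block_monom m k false) *: 'X).

Lemma block_evalE y :
  block_eval y = \sum_(m <- msupp p) p@_m * \prod_k block_monom m k (y k).
Proof.
rewrite /block_eval mevalE; apply: eq_bigr => m _; congr (_ * _).
rewrite (partition_big blk predT) //=; apply: eq_bigr => k _.
by apply: eq_bigr => i /eqP ->.
Qed.

(** A block contributes a factor of degree at most 1, and a constant one if the monomial has no
    variable in it. So a monomial of degree [e] yields degree at most [e]. *)
Lemma size_bernoulli_poly : (size bernoulli_poly <= msize p)%N.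
Proof.
apply: (leq_trans (size_sum _ _ _)); apply/bigmax_leqP_seq => m mp _.
apply: (leq_trans (size_scale_leq _ _)).
apply: leq_trans (msize_mdeg_lt mp).
apply: (leq_trans (size_poly_prod_leq _ _)).
rewrite leq_subLR addnS ltnS mdegE (partition_big blk predT) //=.
rewrite -sum1_card -big_split /=; apply: leq_sum => k _.
rewrite (leq_trans (size_polyD _ _)) // geq_max (leq_trans (size_polyC_leq1 _)) //=.
have [s0|s0] := posnP (\sum_(i | blk i == k) m i).
  have monom1 b : block_monom m k b = 1.
    apply: big1 => i ik; move/eqP: s0; rewrite sum_nat_eq0 => /forallP/(_ i).
    by rewrite ik => /eqP ->.
  by rewrite !monom1 subrr scale0r size_poly0.
by rewrite (leq_trans (size_scale_leq _ _)) // size_polyX ltnS.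
Qed.

Lemma horner_bernoulli_poly t :
  bernoulli_poly.[t] = \sum_y bernoulli_weight t y * block_eval y.
Proof.
under eq_bigr => y _ do rewrite block_evalE mulr_sumr.
rewrite exchange_big /= horner_sum; apply: eq_bigr => m _.
under [RHS]eq_bigr => y _ do rewrite mulrCA -big_split /=.
rewrite -mulr_sumr hornerZ horner_prod; congr (_ * _).
rewrite -(bigA_distr_bigA
  (fun k b => (if b then t else 1 - t) * block_monom m k b)) /=.
apply: eq_bigr => k _; rewrite big_bool /= !hornerE; ring.
Qed.

Lemma sum_bernoulli_weight t : \sum_y bernoulli_weight t y = 1.
Proof.
rewrite -(bigA_distr_bigA (fun _ b => if b then t else 1 - t)) /=.
by apply: big1 => k _; rewrite big_bool /= addrC subrK.
Qed.

Lemma horner0_bernoulli_poly : bernoulli_poly.[0] = block_eval [ffun=> false].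
Proof.
rewrite horner_sum block_evalE; apply: eq_bigr => m _.
rewrite hornerZ horner_prod; congr (_ * _); apply: eq_bigr => k _.
by rewrite !hornerE ffunE.
Qed.

(** The product rule at 0 differentiates one block factor and leaves all others at bit 0, so only
    single-block flips appear. *)
Lemma coef1_bernoulli_poly :
  bernoulli_poly`_1 =
    \sum_k (block_eval [ffun j => j == k] - block_eval [ffun=> false]).
Proof.
under eq_bigr => k _ do rewrite !block_evalE -sumrB.
rewrite exchange_big /= coef_sum; apply: eq_bigr => m _.
under [RHS]eq_bigr => k _ do rewrite -mulrBr.
rewrite -mulr_sumr coefZ; congr (_ * _).
set P := \prod_k _; have -> : P`_1 = (P^`()).[0] by rewrite horner_coef0 coef_deriv.
rewrite deriv_prod ?index_enum_uniq // horner_sum; apply: eq_bigr => k _.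
rewrite hornerM horner_prod [X in _ = X - _](bigD1 k) // [X in _ = _ - X](bigD1 k) //=.
rewrite !ffunE eqxx !derivE !hornerE mulrBl; congr (_ * _ - _ * _).
  by apply: eq_bigr => j jk; rewrite !hornerE ffunE (negPf jk).
by apply: eq_bigr => j jk; rewrite !hornerE ffunE.
Qed.

End BernoulliSymmetrization.

Lemma bernoulli_weight_ge0 (R : realDomainType) (K : finType) (t : R)
    (y : {ffun K -> bool}) : 0 <= t <= 1 -> 0 <= bernoulli_weight t y.
Proof.
by move=> /andP[t0 t1]; apply: prodr_ge0 => k _; case: (y k) => //; rewrite subr_ge0.
Qed.

(** On [[0, 1]] the polynomial is a weighted average of values within [c] of [a]. *)
Lemma norm_bernoulli_poly_le (R : realDomainType) (n : nat) (K : finType)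
    (p : {mpoly R[n]}) (blk : 'I_n -> K) (v : 'I_n -> bool -> R) (a c t : R) :
  (forall y, `|block_eval p blk v y - a| <= c) -> 0 <= t <= 1 ->
  `|(bernoulli_poly p blk v).[t] - a| <= c.
Proof.
move=> Fc t01.
rewrite horner_bernoulli_poly -[a]mul1r -[1](sum_bernoulli_weight (K := K) t).
rewrite mulr_suml -sumrB -[c]mul1r -[X in _ <= X * _](sum_bernoulli_weight (K := K) t).
rewrite mulr_suml; apply: (le_trans (ler_norm_sum _ _ _)); apply: ler_sum => y _.
by rewrite -mulrBr normrM ger0_norm ?bernoulli_weight_ge0 // ler_wpM2l ?bernoulli_weight_ge0.
Qed.

(** * From sensitive blocks to the degree bound *)

Lemma card_sensitive_blocks_le (R : realType) (n : nat) (f : cube n -> bool)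
    (p : {mpoly R[n]}) (x : cube n) (P : {set {set 'I_n}}) :
  eps_approx 3%:R^-1 p f -> trivIset P ->
  (forall B, B \in P -> f (flip x B) != f x) ->
  (#|P| <= 4 * mdegree p ^ 2)%N.
Proof.
move=> fp tP sens.
pose z (y : {ffun {set 'I_n} -> bool}) : cube n :=
  [ffun i => x i (+) ((i \in cover P) && y (pblock P i))].
pose v i b : R := (x i (+) ((i \in cover P) && b))%:R.
pose F := block_eval p (pblock P) v.
have FE y : F y = p.@[embed R (z y)].
  by apply: meval_eq => i; rewrite /embed ffunE.
have F0 : F [ffun=> false] = p.@[embed R x].
  by rewrite FE; apply: meval_eq => i; rewrite /embed !ffunE andbF addbF.
have FB B : B \in P -> F [ffun C => C == B] = p.@[embed R (flip x B)].
  move=> BP; rewrite FE; apply: meval_eq => i; rewrite /embed !ffunE.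
  congr (_ (+) _)%:R; apply/andP/idP => [[iP /eqP <-]|iB].
    by rewrite mem_pblock.
  by rewrite (def_pblock tP BP iB) eqxx; split=> //; apply/bigcupP; exists B.
have FN B : B \notin P -> F [ffun C => C == B] = F [ffun=> false].
  move=> BP; rewrite F0 FE; apply: meval_eq => i; rewrite /embed !ffunE.
  case: (boolP (i \in cover P)) => iP; last by rewrite addbF.
  rewrite [_ == B](_ : _ = false) ?addbF //; apply: contraNF BP => /eqP <-.
  exact: pblock_mem.
have Fbnd y : `|F y - 2^-1| <= 5 / 6.
  have := fp (z y); rewrite -FE !ler_norml => /andP[].
  by case: (f (z y)) => /= ? ?; apply/andP; split; lra.
(* The sign makes [r(0) <= -1/6] whichever value [f] takes at [x]. *)
pose s : R := (-1) ^+ f x.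
pose q := bernoulli_poly p (pblock P) v.
pose r : {poly R} := s *: (q - (2^-1)%:P).
have r0E : r.[0] = s * (F [ffun=> false] - 2^-1).
  by rewrite hornerZ hornerD hornerN hornerC horner0_bernoulli_poly.
rewrite -(ler_nat R) natrM natrX; apply: (@bounded_jump_le R _ _ r) => //.
- apply: (leq_trans (size_scale_leq _ _)).
  rewrite (leq_trans (size_polyD _ _)) // geq_max size_polyN.
  rewrite (leq_trans (size_polyC_leq1 _)) // andbT.
  by rewrite (leq_trans (size_bernoulli_poly _ _ _)) // /mdegree leqSpred.
- move=> t t01; rewrite hornerZ normrM normr_sign mul1r hornerD hornerN hornerC.
  exact: norm_bernoulli_poly_le.
- rewrite r0E F0; have := fp x; rewrite ler_norml => /andP[].
  by rewrite /s; case: (f x); rewrite ?expr1 ?expr0 /=; lra.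
have rc : r`_1 = \sum_(B in P) s * (F [ffun C => C == B] - F [ffun=> false]).
  rewrite coefZ coefD coefN coefC subr0 coef1_bernoulli_poly mulr_sumr.
  rewrite (bigID (mem P)) /= [X in _ + X]big1 ?addr0 // => B BP.
  by rewrite -/F (FN _ BP) subrr mulr0.
(* Flipping a sensitive block brings the signed, centred value to at least [1/6], so each block adds
   at least [1/6 - r(0)]. *)
rewrite rc -sum1_card natr_sum mulr_suml; apply: ler_sum => B BP.
rewrite mul1r r0E (FB _ BP); have := fp (flip x B); have := sens _ BP.
rewrite /s; case: (f x); case: (f (flip x B)) => // _; rewrite ler_norml => /andP[];
  rewrite ?expr1 ?expr0 /=; lra.
Qed.

(** Squared, this is [96 <= 101]. *)
Lemma sqrt_constant_le (R : realType) : Num.sqrt (6%:R / 101%:R : R) <= 4^-1.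
Proof.
rewrite -(@ger0_norm R 4^-1) ?invr_ge0 // -sqrtr_sqr ler_sqrt //; lra.
Qed.

Theorem theorem2 (R : realType) (n : nat) (f : cube n -> bool) :
  (1 <= n)%N ->
  Num.sqrt (6%:R / 101%:R : R) * (bs f)%:R <= ((approx_deg R f) ^ 2)%N%:R.
Proof.
move=> _; rewrite /approx_deg; case: ex_minnP => d /asboolP[p [fp pd]] _.
have bs_le : (bs f <= 4 * d ^ 2)%N.
  apply/bigmax_leqP => x _; apply/bigmax_leqP => P /andP[tP /forall_inP sens].
  by rewrite -pd; exact: card_sensitive_blocks_le fp tP sens.
apply: (le_trans (ler_wpM2r (ler0n _ _) (sqrt_constant_le R))).
by rewrite ler_pdivrMl // -[4]/(4%:R) -natrM ler_nat.
Qed.
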